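(* There is a quantum algorithm that solves the Single Source Longest Path Search problem on a weighted DAG $G=(V,E)$ with $n=|V|$, $m=|E|$, with expected running time $O(\sqrt{nm}\log n)$ and error probability $O(1/n)$.
   Context: Single Source Longest Path Search problem: given a weighted directed acyclic graph $G=(V,E)$, $V=\{v_1,\dots,v_n\}$, topologically sorted (each edge $(v_i,v_j)$ has $i<j$), with edge weights $w(i,j)$ for $(v_i,v_j)\in E$, and a source vertex $v_s$, compute $t[1],\dots,t[n]$, where $t[i]$ is the length (total weight) of the longest path from $v_s$ to $v_i$, and $t[i]=-\infty$ if $v_i$ is not reachable from $v_s$. Query model: the algorithm accesses the graph's adjacency (neighbour) lists and weights through a black-box oracle; running time is the number of queries. *)

(* Defs.v *)
From HB Require Import structures.
From mathcomp Require Import all_boot all_order all_algebra.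
From mathcomp Require Import spectral.
From mathcomp Require Import boolp classical_sets reals ereal exp.
From mathcomp Require Import complex.

Set Implicit Arguments.
Unset Strict Implicit.
Unset Printing Implicit Defensive.
Import Order.TTheory GRing.Theory Num.Theory.
Local Open Scope ring_scope.
Local Open Scope complex_scope.

(* The library does not join the finType and zmodType structures of products. *)
HB.saturate prod.

(* Quantum query algorithms over R[i], with classical control.  The Hilbert
   space has the orthonormal basis [qbasis Q A W]: a query register Q, an answer
   register A and a workspace W.  Column vectors are indexed through
   enum_rank / enum_val.  States are not renormalised after a measurement: the
   squared norm of a state is the probability of reaching it. *)

Definition qbasis (Q : finType) (A : finZmodType) (W : finType) : finType :=
  (Q * A * W)%type.

Section Programs.
Variables (R : realType) (Q : finType) (A : finZmodType) (W : finType).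
Variable T : Type.

Local Notation B := (qbasis Q A W).

Definition qstate := 'cV[R[i]]_#|B|.

(* [Measure f k] is the projective measurement of the observable f, followed by
   the continuation selected by the observed value.  Programs are finite trees,
   so the number of queries of a run is random but always finite. *)
Inductive qprog : Type :=
| Return of T
| Apply (U : 'M[R[i]]_#|B|) of U \is unitarymx & qprog
| Query of qprog
| Measure (M : finType) (f : B -> M) of M -> qprog.

Definition ket (b : B) : qstate := delta_mx (enum_rank b) 0.

Definition sqnorm (psi : qstate) : R :=
  \sum_i ((complex.Re (psi i 0)) ^+ 2 + (complex.Im (psi i 0)) ^+ 2).

Definition project (M : finType) (f : B -> M) (x : M) (psi : qstate) : qstate :=
  \col_i (if f (enum_val i) == x then psi i 0 else 0).

(* |q, a, w> |-> |q, a + O q, w> *)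
Definition query_basis (O : Q -> A) (b : B) : B :=
  (b.1.1, b.1.2 + O b.1.1, b.2).

Definition query_mx (O : Q -> A) : 'M[R[i]]_#|B| :=
  \matrix_(i, j) (enum_val i == query_basis O (enum_val j))%:R.

Fixpoint prog_prob (O : Q -> A) (E : set T) (p : qprog) (psi : qstate) : R :=
  match p with
  | Return t => if `[< E t >] then sqnorm psi else 0
  | Apply U _ p' => prog_prob O E p' (U *m psi)
  | Query p' => prog_prob O E p' (query_mx O *m psi)
  | Measure M f k => \sum_(x : M) prog_prob O E (k x) (project f x psi)
  end.

Fixpoint prog_cost (O : Q -> A) (p : qprog) (psi : qstate) : R :=
  match p with
  | Return _ => 0
  | Apply U _ p' => prog_cost O p' (U *m psi)
  | Query p' => sqnorm psi + prog_cost O p' (query_mx O *m psi)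
  | Measure M f k => \sum_(x : M) prog_cost O (k x) (project f x psi)
  end.

End Programs.

Record qalgorithm (R : realType) (Q : finType) (A : finZmodType) (T : Type) :=
  QAlgorithm {
    qworkspace : finType;
    qinit : qbasis Q A qworkspace;
    qbody : qprog R Q A qworkspace T
  }.

Definition prob_output (R : realType) (Q : finType) (A : finZmodType) (T : Type)
    (a : qalgorithm R Q A T) (O : Q -> A) (E : set T) : R :=
  prog_prob O E (qbody a) (ket R (qinit a)).

Definition expected_queries (R : realType) (Q : finType) (A : finZmodType)
    (T : Type) (a : qalgorithm R Q A T) (O : Q -> A) : R :=
  prog_cost O (qbody a) (ket R (qinit a)).

(* Topologically sorted weighted DAGs on n.+1 vertices.  Since an answer
   register is finite, weights are given by codes in 'I_D.+1; the real number
   denoted by a code is given by a table wt : 'I_D.+1 -> R, with D and wt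
   arbitrary.  [nbrs G j] lists, in arbitrary order, the neighbours of v_j along
   its incoming edges. *)
Record wdag (n D : nat) := WDag {
  edge : rel 'I_n.+1;
  edge_topo : forall i j, edge i j -> (i < j)%N;
  wcode : 'I_n.+1 -> 'I_n.+1 -> 'I_D.+1;
  nbrs : 'I_n.+1 -> seq 'I_n.+1;
  nbrs_uniq : forall j, uniq (nbrs j);
  mem_nbrs : forall i j, (i \in nbrs j) = edge i j
}.

Definition nedges n D (G : wdag n D) : nat :=
  #|[set e : 'I_n.+1 * 'I_n.+1 | edge G e.1 e.2]|.

Definition dag_query (n : nat) : finType := ('I_n.+1 * 'I_n.+1)%type.
Definition dag_answer (n D : nat) : finZmodType := ('I_n.+1 * 'I_D.+1)%type.

(* The query (j, k) returns the entry of index k of the list of v_j, together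
   with the weight code of that edge, and 0 beyond the end of the list. *)
Definition dag_oracle n D (G : wdag n D) (q : dag_query n) : dag_answer n D :=
  if (q.2 < size (nbrs G q.1))%N then
    let i := nth ord0 (nbrs G q.1) q.2 in (i, wcode G i q.1)
  else (0, 0).

Section LongestPaths.
Variables (R : realType) (n D : nat) (wt : 'I_D.+1 -> R) (G : wdag n D).

Definition weight (i j : 'I_n.+1) : R := wt (wcode G i j).

(* The path with vertices s :: p; the empty path joins s to itself. *)
Definition is_path (s i : 'I_n.+1) (p : seq 'I_n.+1) : bool :=
  path (edge G) s p && (last s p == i).

Definition path_length (s : 'I_n.+1) (p : seq 'I_n.+1) : R :=
  \sum_(e <- zip (s :: p) p) weight e.1 e.2.

Definition is_longest_length (s i : 'I_n.+1) (x : \bar R) : Prop :=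
  match x with
  | (r%:E)%E => (exists2 p, is_path s i p & path_length s p = r) /\
            (forall p, is_path s i p -> path_length s p <= r)
  | +oo%E => False
  | -oo%E => forall p, ~~ is_path s i p
  end.

Definition solves_longest_paths (s : 'I_n.+1) (t : 'I_n.+1 -> \bar R) : Prop :=
  forall i, is_longest_length s i (t i).

End LongestPaths.

(* Main.v *)
Require Import Defs.
From HB Require Import structures.
From mathcomp Require Import all_boot all_order all_algebra.
From mathcomp Require Import spectral.
From mathcomp Require Import boolp classical_sets reals ereal exp trigo.
From mathcomp Require Import complex ring lra.

Set Implicit Arguments.
Unset Strict Implicit.
Unset Printing Implicit Defensive.
Import Order.TTheory GRing.Theory Num.Theory.
Local Open Scope ring_scope.

(** The vertices are processed in topological order; the value of a vertex other
than the source is the maximum of t[i] + w(i, j) over its in-neighbours, found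
by quantum search.  A round of index i runs (3^i - 1)/2 Grover iterations on the
d entries of the list, marking those better than the current best value.  If r
entries are better, the round hits each of them with the same probability, p/r,
where p = sin^2 (3^i theta) and sin^2 theta = r/d.  Tripling the angle cannot
jump over the region p >= 1/4, so among the rounds i = 0, ..., log_9 d (a sweep,
O(sqrt d) queries) one succeeds with probability at least 1/4, whatever r is.  A
uniformly chosen better entry halves r in expectation, hence a sweep multiplies
the expectation of r by at most 7/8, and after O(log n) sweeps this expectation,
which bounds the probability that the maximum has been missed, is O(1/n^2).  The
number of queries is deterministic, and Cauchy-Schwarz gives
sum_j sqrt (deg j) <= sqrt (n m). *)

(** * Query count and probabilities of programs *)

Section QueryCount.
Variables (R : realType) (Q : finType) (A : finZmodType) (W : finType).
Variable T : Type.

Local Notation B := (qbasis Q A W).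
Local Notation state := (qstate R Q A W).
Local Notation prog := (qprog R Q A W T).

Lemma sqnorm_ge0 (psi : state) : 0 <= sqnorm psi.
Proof. by apply: sumr_ge0 => i _; rewrite addr_ge0 ?sqr_ge0. Qed.

Lemma sqnormE (psi : state) :
  (sqnorm psi)%:C%C = (map_mx Num.conj psi^T *m psi) 0 0.
Proof.
rewrite mxE /sqnorm raddf_sum; apply: eq_bigr => i _; rewrite !mxE.
by case: (psi i 0) => a b /=; apply/eqP; rewrite eq_complex /=;
  apply/andP; split; apply/eqP; ring.
Qed.

Lemma sqnorm_unitary (U : 'M[R[i]]_#|B|) (psi : state) :
  U \is unitarymx -> sqnorm (U *m psi) = sqnorm psi.
Proof.
move=> /unitarymxP/mulmx1C UU; apply: complexI; rewrite !sqnormE.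
by rewrite trmx_mul map_mxM -mulmxA (mulmxA _ U psi) UU mul1mx.
Qed.

Lemma query_basis_inj (O : Q -> A) : injective (@query_basis Q A W O).
Proof.
by move=> [[q a] w] [[q' a'] w'] [<- /addIr <- <-].
Qed.

Lemma query_mxE (O : Q -> A) (psi : state) b :
  (query_mx R W O *m psi) (enum_rank (query_basis O b)) 0 =
  psi (enum_rank b) 0.
Proof.
rewrite mxE (bigD1 (enum_rank b)) //= big1 ?addr0.
  by rewrite mxE !enum_rankK eqxx mul1r.
move=> i ib; rewrite mxE enum_rankK (inj_eq (@query_basis_inj O)).
by rewrite eq_sym (can2_eq (@enum_valK B) (@enum_rankK B)) (negPf ib) mul0r.
Qed.

Lemma sqnorm_query (O : Q -> A) (psi : state) :
  sqnorm (query_mx R W O *m psi) = sqnorm psi.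
Proof.
rewrite /sqnorm [LHS](reindex (@enum_rank B)) /=; last first.
  by exists (@enum_val B _) => x _; [exact: enum_rankK | exact: enum_valK].
rewrite (reindex_inj (@query_basis_inj O)).
rewrite [RHS](reindex (@enum_rank B)) /=; last first.
  by exists (@enum_val B _) => x _; [exact: enum_rankK | exact: enum_valK].
by apply: eq_bigr => b _; rewrite query_mxE.
Qed.

Lemma sqnorm_project (M : finType) (f : B -> M) (psi : state) :
  \sum_x sqnorm (project f x psi) = sqnorm psi.
Proof.
rewrite /sqnorm exchange_big /=; apply: eq_bigr => i _.
rewrite (bigD1 (f (enum_val i))) //= big1 ?addr0; first by rewrite mxE eqxx.
by move=> x; rewrite mxE eq_sym => /negPf -> /=; rewrite expr0n addr0.
Qed.

Fixpoint query_depth (p : prog) : nat :=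
  match p with
  | Return _ => 0
  | Apply U _ p' => query_depth p'
  | Query p' => (query_depth p').+1
  | Measure M f k => \max_x query_depth (k x)
  end.

(** Unitaries and queries preserve the squared norm and a measurement splits it among its outcomes,
    so the expected count is at most the count on the worst branch times the initial squared
    norm. *)
Lemma prog_cost_le (O : Q -> A) (p : prog) (psi : state) :
  prog_cost O p psi <= (query_depth p)%:R * sqnorm psi.
Proof.
elim: p psi => [t|U HU p IH|p IH|M f k IH] psi /=.
- by rewrite mul0r.
- by apply: le_trans (IH _) _; rewrite sqnorm_unitary.
- by rewrite -natr1 mulrDl mul1r addrC lerD2r -(sqnorm_query O); exact: IH.
- rewrite -(sqnorm_project f psi) mulr_sumr; apply: ler_sum => x _.
  apply: le_trans (IH _ _) _; apply: ler_wpM2r; first exact: sqnorm_ge0.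
  by rewrite ler_nat leq_bigmax.
Qed.

Lemma prog_prob_le (O : Q -> A) E (p : prog) (psi : state) :
  prog_prob O E p psi <= sqnorm psi.
Proof.
elim: p psi => [t|U HU p IH|p IH|M f k IH] psi /=.
- by case: ifP => // _; exact: sqnorm_ge0.
- by apply: le_trans (IH _) _; rewrite sqnorm_unitary.
- by apply: le_trans (IH _) _; rewrite sqnorm_query.
- by rewrite -(sqnorm_project f psi); apply: ler_sum => x _; exact: IH.
Qed.

Lemma sqnormZ (c : R) (psi : state) :
  sqnorm (c%:C%C *: psi) = c ^+ 2 * sqnorm psi.
Proof.
rewrite /sqnorm mulr_sumr; apply: eq_bigr => i _; rewrite mxE.
by case: (psi i 0) => a b /=; ring.
Qed.

(** A complete measurement leaves a scalar multiple of a basis vector; the square of that scalar,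
    taken out here, becomes the probability of the outcome. *)
Lemma prog_probZ (O : Q -> A) E (p : prog) (c : R) (psi : state) :
  prog_prob O E p (c%:C%C *: psi) = c ^+ 2 * prog_prob O E p psi.
Proof.
elim: p psi => [t|U HU p IH|p IH|M f k IH] psi /=.
- by rewrite sqnormZ; case: ifP; rewrite ?mulr0.
- by rewrite -scalemxAr IH.
- by rewrite -scalemxAr IH.
- rewrite mulr_sumr; apply: eq_bigr => x _; rewrite -IH; congr prog_prob.
  by apply/colP => i; rewrite !mxE; case: ifP; rewrite ?mulr0.
Qed.

Lemma sqnorm_ket (b : B) : sqnorm (ket R b) = 1.
Proof.
rewrite /sqnorm (bigD1 (enum_rank b)) //= big1 => [|i ib].
  by rewrite mxE !eqxx /= expr1n expr0n !addr0.
by rewrite mxE (negPf ib) /= expr0n addr0.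
Qed.

End QueryCount.

(** * Real states and the unitaries used by the search *)

Section RealStates.
Variables (R : realType) (Q : finType) (A : finZmodType) (W : finType).

Local Notation B := (qbasis Q A W).
Local Notation state := (qstate R Q A W).

(** All gates of the search have real entries, so states are handled as real functions on the
    basis. *)
Definition rvec (f : B -> R) : state := \col_i (f (enum_val i))%:C%C.

Definition rmx (K : B -> B -> R) : 'M[R[i]]_#|B| :=
  \matrix_(i, j) (K (enum_val i) (enum_val j))%:C%C.

Lemma eq_rvec f g : f =1 g -> rvec f = rvec g.
Proof. by move=> fg; apply/colP => i; rewrite !mxE fg. Qed.

Lemma sum_enum_val (V : nmodType) (F : B -> V) :
  \sum_(i < #|B|) F (enum_val i) = \sum_b F b.
Proof.
rewrite (reindex (@enum_rank B)) /=; last first.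
  by exists (@enum_val B _) => x _; [exact: enum_rankK | exact: enum_valK].
by apply: eq_bigr => b _; rewrite enum_rankK.
Qed.

Lemma rmx_rvec K f : rmx K *m rvec f = rvec (fun x => \sum_y K x y * f y).
Proof.
apply/colP => i; rewrite !mxE raddf_sum /= -sum_enum_val.
by apply: eq_bigr => j _; rewrite !mxE rmorphM.
Qed.

Lemma rmx_unitary K :
  (forall x y, \sum_z K x z * K y z = (x == y)%:R) -> rmx K \is unitarymx.
Proof.
move=> KK; apply/unitarymxP/matrixP => i j; rewrite !mxE.
rewrite -(inj_eq enum_val_inj) -(rmorph_nat (@real_complex R)) -KK.
rewrite -(sum_enum_val (fun z => K _ z * K _ z)) rmorph_sum.
apply: eq_bigr => k _; rewrite !mxE rmorphM; congr (_ * _).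
by apply/eqP; rewrite eq_complex /= oppr0 !eqxx.
Qed.

Lemma ket_rvec b : ket R b = rvec (fun x => (x == b)%:R).
Proof.
apply/colP => i; rewrite !mxE eqxx andbT rmorph_nat.
by rewrite (can2_eq (@enum_valK B) (@enum_rankK B)).
Qed.

Lemma query_rvec (O : Q -> A) f :
  query_mx R W O *m rvec f =
  rvec (fun x => f (x.1.1, x.1.2 - O x.1.1, x.2)).
Proof.
apply/colP => i; rewrite -(enum_valK i).
case: (enum_val i) => [[q a] w].
have -> : (q, a, w) = query_basis O (q, a - O q, w).
  by rewrite /query_basis /= subrK.
by rewrite query_mxE !mxE !enum_rankK /= addrK.
Qed.

Lemma project_id_rvec b f : project id b (rvec f) = (f b)%:C%C *: ket R b.
Proof.
rewrite ket_rvec; apply/colP => i; rewrite !mxE rmorph_nat.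
by case: eqP => [->|_]; rewrite ?mulr1 ?mulr0.
Qed.

(** The Householder reflection [1 - 2 v v^T / |v|^2]. *)
Definition reflection (v : B -> R) (x y : B) : R :=
  (x == y)%:R - 2 / (\sum_z v z ^+ 2) * v x * v y.

Lemma reflectionE v f x :
  \sum_y reflection v x y * f y =
  f x - 2 / (\sum_z v z ^+ 2) * (\sum_y v y * f y) * v x.
Proof.
under eq_bigr do rewrite mulrBl; rewrite sumrB (bigD1 x) //= eqxx mul1r.
rewrite big1 ?addr0 => [|y /negPf yx]; last by rewrite eq_sym yx mul0r.
by rewrite mulr_sumr mulr_suml; congr (_ - _); apply: eq_bigr => y _; ring.
Qed.

Lemma reflection_unitary v : rmx (reflection v) \is unitarymx.
Proof.
apply: rmx_unitary => x y; rewrite reflectionE /reflection.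
set N := \sum_z _; rewrite [y == x]eq_sym.
have -> : \sum_z v z * ((y == z)%:R - 2 / N * v y * v z) =
          v y - 2 / N * v y * N.
  under eq_bigr do rewrite mulrBr; rewrite sumrB (bigD1 y) //= eqxx mulr1.
  rewrite big1 ?addr0 => [|z /negPf zy]; last by rewrite eq_sym zy mulr0.
  by rewrite /N mulr_sumr; congr (_ - _); apply: eq_bigr => z _; ring.
have [->|N0] := eqVneq N 0; first by rewrite invr0; ring.
by field.
Qed.

(* Since [2 / 0 = 0], this is the identity when [b = c]. *)
Lemma reflection_swap b c :
  rmx (reflection (fun x => (x == b)%:R - (x == c)%:R)) *m ket R b = ket R c.
Proof.
rewrite !ket_rvec rmx_rvec; apply: eq_rvec => x; rewrite reflectionE.
have [->|bc] := eqVneq b c.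
  by rewrite big1 ?invr0 => [|y _]; [rewrite !(mulr0, mul0r) subr0 | ring].
have -> : \sum_z ((z == b)%:R - (z == c)%:R) ^+ 2 = 2 :> R.
  rewrite (bigD1 b) //= (bigD1 c) 1?eq_sym //= big1 => [|z].
    by rewrite !eqxx [c == b]eq_sym (negPf bc) /=; ring.
  by move=> /andP[/negPf -> /negPf ->]; rewrite subrr expr0n.
rewrite (bigD1 b) //= big1 => [|z /negPf ->]; last by rewrite mulr0.
by rewrite eqxx (negPf bc) /= !mulr1n mulr0n; field.
Qed.

Definition answer_opp (x y : B) : R := (x == (y.1.1, - y.1.2, y.2))%:R.

Lemma answer_oppE f x :
  \sum_y answer_opp x y * f y = f (x.1.1, - x.1.2, x.2).
Proof.
case: x => [[q a] w]; rewrite (bigD1 (q, - a, w)) //= big1 => [|y].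
  by rewrite /answer_opp opprK eqxx mul1r addr0.
case: y => [[q' a'] w']; rewrite /answer_opp /= => ne.
have [E|_] := eqVneq (q, a, w) (q', - a', w'); last by rewrite mul0r.
by case: E ne => -> -> ->; rewrite opprK eqxx.
Qed.

Lemma answer_opp_unitary : rmx answer_opp \is unitarymx.
Proof.
apply: rmx_unitary => -[[q a] w] [[q' a'] w'].
by rewrite answer_oppE /answer_opp /= opprK eq_sym.
Qed.

Definition sign_flip (P : pred B) (x y : B) : R :=
  (x == y)%:R * (-1) ^+ (P x).

Lemma sign_flipE P f x : \sum_y sign_flip P x y * f y = (-1) ^+ (P x) * f x.
Proof.
rewrite (bigD1 x) //= big1 => [|y /negPf yx]; last first.
  by rewrite /sign_flip eq_sym yx !mul0r.
by rewrite /sign_flip eqxx mul1r addr0.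
Qed.

Lemma sign_flip_unitary P : rmx (sign_flip P) \is unitarymx.
Proof.
apply: rmx_unitary => x y; rewrite sign_flipE /sign_flip [y == x]eq_sym.
by case: eqP => [->|_]; rewrite ?mul0r ?mulr0 // mul1r -expr2 sqrr_sign.
Qed.

End RealStates.

(** * Grover amplitudes *)

Section GroverAmplitudes.
Variable R : realType.
Implicit Types (r d x : R) (t i : nat).

(* Amplitudes of the marked and of the unmarked elements after [t] Grover
   iterations on [d] elements, [r] of which are marked. *)
Fixpoint grover_amp r d t : R * R :=
  if t is t'.+1 then
    let: (x, y) := grover_amp r d t' in
    let s := ((d - r) * y - r * x) / d in (- x - 2 * s, y - 2 * s)
  else ((Num.sqrt d)^-1, (Num.sqrt d)^-1).

(** An iteration flips the marked amplitudes and then subtracts twice the mean [s] from all of them,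
    an isometry for the form with weights [r] and [d - r]. *)
Lemma grover_amp_norm r d t : 0 < d ->
  r * (grover_amp r d t).1 ^+ 2 + (d - r) * (grover_amp r d t).2 ^+ 2 = 1.
Proof.
move=> d0; elim: t => [|t] /=.
  by rewrite exprVn sqr_sqrtr ?ltW // -mulrDl addrC subrK divff ?lt0r_neq0.
have d0n := lt0r_neq0 d0.
by case: (grover_amp r d t) => x y /= IH; rewrite -[RHS]IH; field.
Qed.

(** On the plane spanned by the uniform marked and unmarked vectors, an iteration is, up to sign,
    the rotation by [2 * theta]. *)
Lemma grover_amp_sin r d : 0 < d -> 0 <= r <= d ->
  exists2 theta : R, sin theta ^+ 2 = r / d &
    forall t, r * (grover_amp r d t).1 ^+ 2 =
              sin (t.*2.+1%:R * theta) ^+ 2.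
Proof.
move=> d0 /andP[r0 rd].
have d0' := lt0r_neq0 d0.
have rd01 : 0 <= r / d <= 1 by rewrite divr_ge0 ?(ltW d0) //= ler_pdivrMr ?mul1r.
pose s := Num.sqrt (r / d); pose c := Num.sqrt (1 - r / d).
have s2 : s ^+ 2 = r / d by rewrite sqr_sqrtr; case/andP: rd01.
have c2 : c ^+ 2 = 1 - r / d.
  by rewrite sqr_sqrtr // subr_ge0; case/andP: rd01.
have s1 : -1 <= s <= 1.
  have s0 : 0 <= s by rewrite sqrtr_ge0.
  have : s <= 1 by rewrite -(sqrtr1 R) ler_wsqrtr //; case/andP: rd01.
  lra.
pose theta := asin s.
have sE : sin theta = s by rewrite asinK // in_itv.
have cE : cos theta = c by rewrite /theta cos_asin // s2.
exists theta; first by rewrite sE.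
(* The alternating sign appears because subtracting twice the mean is the opposite of the usual
   inversion about the mean. *)
pose a t := (-1) ^+ t * sin (t.*2.+1%:R * theta).
pose b t := (-1) ^+ t * cos (t.*2.+1%:R * theta).
pose e := Num.sqrt d.
have e2 : e ^+ 2 = d by rewrite sqr_sqrtr // ltW.
have e0 : e != 0 by rewrite gt_eqF // sqrtr_gt0.
have rE : r = (e * s) ^+ 2 by rewrite exprMn s2 e2; field.
have drE : d - r = (e * c) ^+ 2 by rewrite exprMn c2 e2; field.
have cs : c ^+ 2 = 1 - s ^+ 2 by rewrite c2 s2.
(* [e * s] and [e * c] are the square roots of [r] and [d - r]; keeping them as factors covers
   [r = 0] and [r = d]. *)
have H t : e * s * (grover_amp r d t).1 = a t /\
           e * c * (grover_amp r d t).2 = b t.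
  elim: t => [|t []].
    rewrite /a /b /= !expr0 !mul1r sE cE -/e.
    by split; field.
  rewrite /a /b /= doubleS.
  have -> : (t.*2.+2.+1)%:R * theta = t.*2.+1%:R * theta + (theta + theta).
    by rewrite -addn2 natrD; ring.
  rewrite !(sinD, cosD) sE cE exprS.
  case: (grover_amp r d t) => x y /=.
  move: (sin _) (cos _) => sn cn Hx Hy.
  have -> : ((d - r) * y - r * x) / d =
            (c * (e * c * y) - s * (e * s * x)) / e.
    by rewrite drE {1}rE -e2; field.
  rewrite Hx Hy; split.

    set u := c * _ - s * _.
    have -> : e * s * (- x - 2 * (u / e)) = - (e * s * x) - 2 * s * u by field.
    by rewrite Hx -!expr2 cs /u; ring.
  set u := c * _ - s * _.
  have -> : e * c * (y - 2 * (u / e)) = e * c * y - 2 * c * u by field.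
  have -> : 2 * c * u =
      2 * (c ^+ 2) * ((-1) ^+ t * cn) - 2 * c * s * ((-1) ^+ t * sn).
    by rewrite /u; ring.
  by rewrite Hy -!expr2 cs; ring.
by move=> t; rewrite {1}rE -exprMn (H t).1 /a exprMn sqrr_sign mul1r.
Qed.

Lemma sin_triple x : sin (3 * x) ^+ 2 = sin x ^+ 2 * (3 - 4 * sin x ^+ 2) ^+ 2.
Proof.
have -> : 3 * x = x + (x + x) by ring.
rewrite sinD cosD sinD -!expr2 cos2sin2.
have -> : cos x * (sin x * cos x + cos x * sin x) = 2 * sin x * cos x ^+ 2 by ring.
by rewrite cos2sin2; ring.
Qed.

(* While [p = sin^2] is below [1/4], the step [p |-> p (3 - 4 p)^2] satisfies
   [1/p' - 5/8 <= (1/p - 5/8) / 9]. *)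
Lemma sin_pow3_large (theta : R) (L : nat) :
  (9 ^+ L)^-1 <= sin theta ^+ 2 ->
  exists2 i, (i <= L)%N & 4^-1 <= sin ((3 ^ i)%:R * theta) ^+ 2.
Proof.
move=> hL.
have h0 : 0 < sin theta ^+ 2 by apply: lt_le_trans hL; rewrite invr_gt0 exprn_gt0.
have step k : (exists2 i, (i <= k)%N & 4^-1 <= sin ((3 ^ i)%:R * theta) ^+ 2) \/
  (0 < sin ((3 ^ k)%:R * theta) ^+ 2 /\
   (sin ((3 ^ k)%:R * theta) ^+ 2)^-1 <= 5 / 8 + (sin theta ^+ 2)^-1 / 9 ^+ k).
  elim: k => [|k [[i ik Hi]|[p0 Hp]]].
  - by right; rewrite expn0 mul1r expr0 divr1 h0; split => //; lra.
  - by left; exists i => //; exact: leqW.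
  rewrite expnS natrM -mulrA sin_triple.
  have [p4|] := leP 4^-1 (sin ((3 ^ k)%:R * theta) ^+ 2).
    by left; exists k.
  move: (sin ((3 ^ k)%:R * theta) ^+ 2) p0 Hp => p p0 Hp p4.
  right.
  have q0 : 0 < p * (3 - 4 * p) ^+ 2.
    by rewrite mulr_gt0 // exprn_gt0 //; lra.
  split => //.
  (* Since [5 / 8] is the fixed point of [u |-> 5 / 9 + u / 9], this inequality propagates the bound
     [Hp]. *)
  have : (p * (3 - 4 * p) ^+ 2)^-1 <= 5 / 9 + p^-1 / 9.
    rewrite -[leLHS]mul1r ler_pdivrMr //.
    have -> : (5 / 9 + p^-1 / 9) * (p * (3 - 4 * p) ^+ 2) =
      (5 * p + 1) * (3 - 4 * p) ^+ 2 / 9 by field; exact: lt0r_neq0.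
    rewrite ler_pdivlMr // mul1r -subr_ge0.
    have -> : (5 * p + 1) * (3 - 4 * p) ^+ 2 - 9 = p * ((4^-1 - p) * (84 - 80 * p)).
      by field.
    by rewrite mulr_ge0 ?mulr_ge0 //; lra.
  have -> : (sin theta ^+ 2)^-1 / 9 ^+ k.+1 = (sin theta ^+ 2)^-1 / 9 ^+ k / 9.
    by rewrite [9 ^+ _]exprS [(9 * _)^-1]invfM mulrA mulrAC.
  by move: (_ / 9 ^+ k) Hp => u; lra.
(* If no index is found directly, the inverse at [L] is at most [5 / 8 + 1 < 4], so [L] itself
   works. *)
have [//|[p0 Hp]] := step L; exists L => //.
have : (sin theta ^+ 2)^-1 / 9 ^+ L <= 1.
  rewrite ler_pdivrMr ?exprn_gt0 // mul1r.
  have L0 : 0 < 9 ^+ L :> R by rewrite exprn_gt0.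
  by rewrite -[leRHS]invrK lef_pV2 ?posrE ?invr_gt0.
move=> h; have {}h : (sin ((3 ^ L)%:R * theta) ^+ 2)^-1 <= 4 by lra.
by rewrite -[leRHS]invrK lef_pV2 ?posrE ?invr_gt0.
Qed.

End GroverAmplitudes.

(** * Quantum maximum finding *)

Section MaximumFinding.
Variables (R : realType) (Q : finType) (A : finZmodType) (T : Type).
Variables (disp : Order.disp_t) (V : orderType disp).
Variables (val : A -> V) (D : {set Q}) (q0 : Q).

Local Notation B := (qbasis Q A bool).
Local Notation prog := (qprog R Q A bool T).
Local Notation b0 := ((q0, 0, true) : B).
Local Notation d := (#|D|%:R : R).

Definition search_space (z : B) : R :=
  ([&& z.1.1 \in D, z.1.2 == 0 & ~~ z.2])%:R.

(** Difference of two orthogonal unit vectors: its reflection sends [b0] to the uniform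
    superposition over [D]. *)
Definition search_init (z : B) : R :=
  (z == b0)%:R - search_space z / Num.sqrt d.

Definition swap_vec (b c x : B) : R := (x == b)%:R - (x == c)%:R.

Definition apply_reflection (v : B -> R) (p : prog) : prog :=
  Apply (reflection_unitary v) p.

Definition apply_answer_opp (p : prog) : prog :=
  Apply (answer_opp_unitary R Q A bool) p.

Definition apply_mark (b : V) (p : prog) : prog :=
  Apply (sign_flip_unitary R (fun z : B => (b < val z.1.2)%O)) p.

(* The second query, conjugated by the negation of the answer register,
   uncomputes the first one. *)
Definition grover_iter (b : V) (p : prog) : prog :=
  Query (apply_mark b (apply_answer_opp (Query (apply_answer_opp
    (apply_reflection search_space p))))).

(** With [t] iterations, [2 t + 1 = 3 ^ i] is both the angle multiplier and the query count, the
    last query writing the answer to be measured. The whole register is measured and returned to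
    [b0]; the best value is classical data handed to the continuation [K]. *)
Definition grover_round (i : nat) (K : V -> prog) (b : V) : prog :=
  apply_reflection search_init
    (iter (3 ^ i).-1./2 (grover_iter b)
      (Query (Measure id (fun z : B =>
        apply_reflection (swap_vec z b0) (K (Order.max b (val z.1.2))))))).

Fixpoint grover_sweep (m : nat) (K : V -> prog) (b : V) : prog :=
  if m is i.+1 then grover_round i (grover_sweep i K) b else K b.

Definition find_max (S m : nat) : (V -> prog) -> V -> prog :=
  iter S (grover_sweep m).

Lemma grover_sweepS m K b :
  grover_sweep m.+1 K b = grover_round m (grover_sweep m K) b.
Proof. by []. Qed.

Lemma find_maxS S m K b :
  find_max S.+1 m K b = grover_sweep m (find_max S m K) b.
Proof. by []. Qed.

Lemma odd_pow3 i : odd (3 ^ i). Proof. by rewrite oddX orbT. Qed.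

Lemma double_half_pow3 i : ((3 ^ i).-1./2.*2.+1 = 3 ^ i)%N.
Proof.
have := odd_pow3 i; case: (3 ^ i)%N => //= k /negbTE ko.
by rewrite -[in RHS](odd_double_half k) ko.
Qed.

Lemma query_depth_grover_iter b t p :
  query_depth (iter t (grover_iter b) p) = (t.*2 + query_depth p)%N.
Proof. by elim: t => //= t ->. Qed.

Lemma query_depth_grover_round i K b N : (forall b', query_depth (K b') <= N)%N ->
  (query_depth (grover_round i K b) <= 3 ^ i + N)%N.
Proof.
move=> KN; rewrite /= query_depth_grover_iter /= addnS -addSn double_half_pow3.
by rewrite leq_add2l; apply/bigmax_leqP => z _ /=; exact: KN.
Qed.

(** The round costs are geometric, so [3 ^ m + 3 ^ m <= 3 ^ m.+1] is all the induction needs. *)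
Lemma query_depth_grover_sweep m K b N : (forall b', query_depth (K b') <= N)%N ->
  (query_depth (grover_sweep m K b) <= 3 ^ m + N)%N.
Proof.
move=> KN; elim: m b => [|m IH] b /=; first exact: leq_trans (KN b) (leq_addl _ _).
apply: leq_trans (query_depth_grover_round _ _ IH) _.
by rewrite addnA leq_add2r expnS addnn -mul2n leq_mul2r orbT.
Qed.

Lemma query_depth_find_max S m K b N : (forall b', query_depth (K b') <= N)%N ->
  (query_depth (find_max S m K b) <= S * 3 ^ m + N)%N.
Proof.
move=> KN; elim: S b => [|S IH] b /=; first exact: leq_trans (KN b) (leq_addl _ _).
by rewrite mulSn -addnA; exact: query_depth_grover_sweep.
Qed.

(** Applied with [h = 0] before the last query of a round and with [h = O] after it. *)
Lemma sum_graph (h : Q -> A) (F : B -> R) :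
  (forall q a w, ~~ [&& q \in D, a == h q & ~~ w] -> F (q, a, w) = 0) ->
  \sum_z F z = \sum_(q in D) F (q, h q, false).
Proof.
move=> F0; transitivity (\sum_(q : Q) \sum_(a : A) \sum_(w : bool) F (q, a, w)).
  rewrite pair_bigA pair_bigA; apply: eq_bigr => -[[q a] w] _ //.
rewrite [RHS]big_mkcond; apply: eq_bigr => q _; case: ifP => qD.
  rewrite (bigD1 (h q)) //= [X in _ + X]big1 => [|a ah]; last first.
    by apply: big1 => w _; rewrite F0 // (negPf ah) andbF.
  by rewrite big_bool /= [F (q, _, true)]F0 ?andbF // add0r addr0.
by apply: big1 => a _; apply: big1 => w _; rewrite F0 // qD.
Qed.

(** * Outcome probabilities of a round *)

Variables (O : Q -> A) (E : set T).

Definition better (b : V) : {set Q} := [set q in D | (b < val (O q))%O].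
(** The potential of the analysis: it vanishes exactly when no entry of [D] beats [b]. *)
Definition rank (b : V) : nat := #|better b|.
Local Notation prob p := (prog_prob O E p (ket R b0)).

Definition search_state (b : V) (xy : R * R) (z : B) : R :=
  search_space z * (if (b < val (O z.1.1))%O then xy.1 else xy.2).

Lemma search_space0 q a w : ~~ [&& q \in D, a == 0 & ~~ w] ->
  search_space (q, a, w) = 0.
Proof. by rewrite /search_space /= => /negPf ->. Qed.

Lemma search_space1 q : q \in D -> search_space (q, 0, false) = 1.
Proof. by rewrite /search_space /= eqxx => ->. Qed.

Lemma sum_better (F : Q -> R) (G : Q -> R) b :
  \sum_(q in D) (if (b < val (O q))%O then F q else G q) =
  \sum_(q in better b) F q + \sum_(q in D :\: better b) G q.
Proof.
rewrite (bigID (fun q => b < val (O q))%O) /=; congr (_ + _).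
  rewrite [LHS](eq_bigl (fun q => q \in better b)) => [|q]; last by rewrite /= inE.
  by apply: eq_bigr => q; rewrite inE => /andP[_ ->].
rewrite [LHS](eq_bigl (fun q => q \in D :\: better b)) => [|q]; last first.
  by rewrite /= !inE; case: (q \in D); rewrite ?andbT ?andbF.
by apply: eq_bigr => q; rewrite !inE => /andP[+ qD]; rewrite qD /= => /negPf ->.
Qed.

Lemma sub_better b : better b \subset D.
Proof. by apply/fintype.subsetP => q; rewrite inE => /andP[]. Qed.

Lemma card_not_better b : #|D :\: better b|%:R = d - (rank b)%:R :> R.
Proof.
by rewrite cardsD (finset.setIidPr (sub_better b)) natrB // subset_leq_card // sub_better.
Qed.

Lemma sum_search_space : \sum_z search_space z ^+ 2 = d.
Proof.
rewrite (@sum_graph (fun=> 0)) => [|q a w /search_space0 ->]; last by rewrite expr0n.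
rewrite (eq_bigr (fun=> 1)) => [|q qD]; last by rewrite search_space1 ?expr1n.
by rewrite sumr_const.
Qed.

(** The iterations preserve the states that are constant on marked and on unmarked entries, so two
    amplitudes describe the evolution. *)
Lemma prob_grover_iter b p t : (0 < #|D|)%N ->
  prog_prob O E (iter t (grover_iter b) p)
    (rvec (search_state b ((Num.sqrt d)^-1, (Num.sqrt d)^-1))) =
  prog_prob O E p (rvec (search_state b (grover_amp (rank b)%:R d t))).
Proof.
move=> D0; elim: t p => [|t IH] p //.
rewrite iterSr IH /= !(query_rvec, rmx_rvec); congr prog_prob; apply: eq_rvec => z.
case: (grover_amp _ _ _) => x y.
(* The two queries cancel on the answer register, and only the sign of the marked amplitudes
   remains. *)
have eqf (z' : B) : \sum_y0 answer_opp R z' y0 *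
  (\sum_y1 answer_opp R (y0.1.1, y0.1.2 - O y0.1.1, y0.2) y1 *
    (\sum_y2 sign_flip R (fun z : B => (b < val z.1.2)%O) y1 y2 *
       search_state b (x, y) (y2.1.1, y2.1.2 - O y2.1.1, y2.2))) =
  search_state b (- x, y) z'.
  rewrite answer_oppE answer_oppE sign_flipE /=.
  case: z' => [[q a] w]; rewrite /search_state /=.
  have -> : - (- a - O q) = a + O q by rewrite opprB opprK addrC.
  rewrite addrK.
  rewrite /search_space /=; case: eqP => [->|_]; last by rewrite andbF !mul0r mulr0.
  rewrite add0r mulrCA; congr (_ * _).
  by case: ifP; rewrite ?expr1 ?mulN1r ?expr0 ?mul1r.
under eq_bigr do rewrite eqf.
rewrite reflectionE sum_search_space.
have -> : \sum_z search_space z * search_state b (- x, y) z =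
   (d - (rank b)%:R) * y - (rank b)%:R * x.
  rewrite (@sum_graph (fun=> 0)) => [|q a w /search_space0 ->]; last by rewrite mul0r.
  rewrite (eq_bigr (fun q => if (b < val (O q))%O then - x else y)) => [|q qD].
    rewrite sum_better !sumr_const -[- x *+ _]mulr_natl -[y *+ _]mulr_natl.
    by rewrite card_not_better /rank; ring.
  by rewrite /search_state search_space1 //= !mul1r.
rewrite /search_state /=; case: ifP => _; rewrite /=; ring.
Qed.

Lemma prob_search_init p : (0 < #|D|)%N ->
  prob (apply_reflection search_init p) =
  prog_prob O E p (rvec (fun z => search_space z / Num.sqrt d)).
Proof.
move=> D0 /=; rewrite ket_rvec rmx_rvec; congr prog_prob; apply: eq_rvec => z.
have d0 : 0 < d by rewrite ltr0n.
have b00 : search_space b0 = 0 by rewrite /search_space /= !andbF.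
have e0 : Num.sqrt d != 0 by rewrite gt_eqF // sqrtr_gt0.
have -> : \sum_y reflection search_init z y * (y == b0)%:R = reflection search_init z b0.
  rewrite (bigD1 b0) //= eqxx mulr1 big1 ?addr0 // => y /negPf ->.
  by rewrite mulr0.
rewrite /reflection {3}/search_init b00 eqxx mul0r subr0 mulr1.
(* Two orthogonal unit vectors contribute 1 each, so the coefficient of the reflection is 1. *)
have -> : \sum_z search_init z ^+ 2 = 2.
  rewrite (bigD1 b0) //= {1}/search_init b00 eqxx mul0r subr0 expr1n.
  rewrite (eq_bigr (fun z => d^-1 * search_space z ^+ 2)) => [|y /negPf yb]; last first.
    rewrite /search_init yb sub0r sqrrN exprMn exprVn sqr_sqrtr ?ltW //.
    by rewrite mulrC.
  rewrite -mulr_sumr; have := sum_search_space.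
  by rewrite (bigD1 b0) //= b00 expr0n add0r => ->; rewrite mulVf ?lt0r_neq0.
by rewrite divff ?pnatr_eq0 // mul1r /search_init; ring.
Qed.

(** After the last query the state is supported on the graph of [O] over [D]. Each better entry is
    hit with probability [amp.1 ^+ 2] and replaces [b]; at any other entry the maximum keeps [b]. *)
Lemma prob_grover_round i K b : (0 < #|D|)%N ->
  let amp := grover_amp (rank b)%:R d (3 ^ i).-1./2 in
  prob (grover_round i K b) =
  amp.1 ^+ 2 * (\sum_(q in better b) prob (K (val (O q)))) +
  (d - (rank b)%:R) * amp.2 ^+ 2 * prob (K b).
Proof.
move=> D0 amp; rewrite /grover_round prob_search_init //.
have -> : rvec (fun z => search_space z / Num.sqrt d) =
  rvec (search_state b ((Num.sqrt d)^-1, (Num.sqrt d)^-1)).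
  by apply: eq_rvec => z; rewrite /search_state /=; case: ifP.
rewrite prob_grover_iter // -/amp /= query_rvec.
under eq_bigr => z _ do
  rewrite project_id_rvec -scalemxAr reflection_swap prog_probZ.
rewrite (@sum_graph O) => [|q a w H]; last first.
  by rewrite /search_state /= search_space0 ?mul0r ?expr0n ?mul0r //= subr_eq0.
transitivity (\sum_(q in D) if (b < val (O q))%O
    then amp.1 ^+ 2 * prob (K (val (O q))) else amp.2 ^+ 2 * prob (K b)).
  apply: eq_bigr => q qD; rewrite /= /search_state /= subrr search_space1 // mul1r.
  by rewrite /Order.max; case: ifP.
by rewrite sum_better -mulr_sumr sumr_const -[(_ * _) *+ _]mulr_natl card_not_better mulrA.
Qed.

(** The sum counts the ordered pairs of better entries with increasing values; a pair and its
    transpose are never both counted, so twice the sum is at most the number of all pairs. *)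
Lemma sum_rank_better b :
  \sum_(q in better b) (rank (val (O q)))%:R <= (rank b)%:R ^+ 2 / 2 :> R.
Proof.
pose F q q' : nat := (val (O q) < val (O q'))%O.
have rankE q : q \in better b -> rank (val (O q)) = (\sum_(q' in better b) F q q')%N.
  rewrite inE => /andP[qD bq].
  rewrite /rank -sum1_card [RHS]big_mkcond [LHS]big_mkcond /=.
  apply: eq_bigr => q' _; rewrite !inE /F.
  case: (q' \in D) => //=; case: ltP => qq' //=; last by case: ifP.
  by rewrite (lt_trans bq qq').
rewrite -natr_sum (eq_bigr _ rankE) ler_pdivlMr // -natrM -natrX ler_nat.
rewrite muln2 -addnn {2}exchange_big /= -big_split /=.
rewrite expnS expn1 /rank -sum_nat_const leq_sum // => q _.
rewrite -big_split /= -sum1_card leq_sum // => q' _.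
by rewrite /F; case: ltgtP.
Qed.

(** * Decrease of the expected rank *)

Section Bound.
Variable valid : V -> Prop.
Hypothesis valid_val : forall q, q \in D -> valid (val (O q)).
Hypothesis D0 : (0 < #|D|)%N.

Definition success i b : R := 
  (rank b)%:R * (grover_amp (rank b)%:R d (3 ^ i).-1./2).1 ^+ 2.

Lemma success_ge0 i b : 0 <= success i b.
Proof. by rewrite mulr_ge0 ?sqr_ge0. Qed.

Lemma success_le1 i b : success i b <= 1.
Proof.
rewrite -(@grover_amp_norm R (rank b)%:R d (3 ^ i).-1./2) ?ltr0n //.
by rewrite lerDl mulr_ge0 ?sqr_ge0 // -card_not_better.
Qed.

(** A success picks a uniform better entry, whose rank is on average at most half of that of [b]; a
    failure continues with the same [b]. *)
Lemma prob_grover_round_le i K b (alpha c : R) : 0 <= c ->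
  (forall b', valid b' -> prob (K b') <= alpha + c * (rank b')%:R) ->
  prob (grover_round i K b) <=
  success i b * (alpha + c * (rank b)%:R / 2) + (1 - success i b) * prob (K b).
Proof.
move=> c0 HK; rewrite prob_grover_round //.
have := grover_amp_norm (rank b)%:R (3 ^ i).-1./2 (_ : 0 < d).
rewrite ltr0n => /(_ D0); rewrite -/(success i b).
rewrite /success; case: grover_amp => x y /= H.
have -> : (d - (rank b)%:R) * y ^+ 2 = 1 - (rank b)%:R * x ^+ 2 by lra.
rewrite lerD2r.
apply: (@le_trans _ _ (x ^+ 2 * ((rank b)%:R * alpha + c * ((rank b)%:R ^+ 2 / 2)))).
  apply: ler_wpM2l; first exact: sqr_ge0.
  apply: (@le_trans _ _ (\sum_(q in better b) (alpha + c * (rank (val (O q)))%:R))).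
    apply: ler_sum => q; rewrite inE => /andP[qD _]; exact/HK/valid_val.
  rewrite big_split /= sumr_const mulr_natl lerD2l -mulr_sumr.
  by apply: ler_wpM2l => //; exact: sum_rank_better.
by rewrite le_eqVlt; apply/orP; left; apply/eqP; field.
Qed.

(** A nonzero rank gives [sin theta ^+ 2 = rank / d >= 1 / 9 ^ m], and round [i] multiplies the
    angle by [3 ^ i]. *)
Lemma exists_success m b : (#|D| <= 9 ^ m)%N -> (0 < rank b)%N ->
  exists2 i, (i <= m)%N & 4^-1 <= success i b.
Proof.
move=> Dm b0; have d0 : 0 < d by rewrite ltr0n.
have rd : (0 : R) <= (rank b)%:R <= d.
  by rewrite ler0n ler_nat subset_leq_card ?sub_better.
have [theta st H] := grover_amp_sin d0 rd.
have [|i im Hi] := @sin_pow3_large R theta m.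
  rewrite st -[leLHS]mul1r ler_pM ?invr_ge0 ?exprn_ge0 ?ler1n //.
  by rewrite lef_pV2 ?posrE ?exprn_gt0 // -natrX ler_nat.
by exists i => //; rewrite /success H double_half_pow3.
Qed.

(** A round halves the rank term on success and keeps it on failure, so a bound linear in the rank
    survives any number of rounds. *)
Lemma prob_grover_sweep_le m K b (alpha c : R) : 0 <= c ->
  (forall b', valid b' -> prob (K b') <= alpha + c * (rank b')%:R) -> valid b ->
  prob (grover_sweep m K b) <= alpha + c * (rank b)%:R.
Proof.
move=> c0 HK; elim: m b => [|m IH] b vb; first exact: HK.
rewrite grover_sweepS; apply: le_trans (prob_grover_round_le _ _ c0 IH) _.
have := IH _ vb; have := success_ge0 m b; have := success_le1 m b.
have : 0 <= c * (rank b)%:R by rewrite mulr_ge0.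
by move: (success _ _) (prob _) (c * _) => p P u; nra.
Qed.

(** As long as rounds fail, [b] does not change, so round [i] is still good when reached; an earlier
    success already halves the expected rank. The factor is [1 - 1 / 4 * 1 / 2 = 7 / 8]. *)
Lemma prob_grover_sweep_good m K b (alpha c : R) : 0 <= c ->
  (forall b', valid b' -> prob (K b') <= alpha + c * (rank b')%:R) -> valid b ->
  (exists2 i, (i < m)%N & 4^-1 <= success i b) ->
  prob (grover_sweep m K b) <= alpha + 7 / 8 * c * (rank b)%:R.
Proof.
move=> c0 HK vb; elim: m => [[//]|m IH [i im si]].
rewrite grover_sweepS.
have HS b' := @prob_grover_sweep_le m K b' _ _ c0 HK.
apply: le_trans (prob_grover_round_le _ _ c0 HS) _.
have : 0 <= c * (rank b)%:R by rewrite mulr_ge0.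
rewrite -!(mulrA _ c).
have [sm|sm] := leP 4^-1 (success m b).
  have := @prob_grover_sweep_le m K b _ _ c0 HK vb; have := success_le1 m b.
  by move: sm; move: (success _ _) (prob _) (c * _) => p P u; nra.
have im' : (i < m)%N.
  by move: im; rewrite ltnS leq_eqVlt => /orP[/eqP im|//]; rewrite im leNgt sm in si.
have := IH (ex_intro2 _ _ i im' si); have := success_ge0 m b; have := success_le1 m b.
rewrite -!(mulrA _ c).
by move: (success _ _) (prob _) (c * _) => p P u; nra.
Qed.

Lemma prob_find_max_le S m K b (alpha : R) : (#|D| <= 9 ^ m)%N ->
  (forall b', valid b' -> prob (K b') <= alpha + (rank b')%:R) -> valid b ->
  prob (find_max S m.+1 K b) <= alpha + (7 / 8) ^+ S * (rank b)%:R.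
Proof.
move=> Dm HK; elim: S b => [|S IH] b vb; first by rewrite expr0 mul1r; exact: HK.
rewrite find_maxS.
have c0 : 0 <= (7 / 8) ^+ S :> R by rewrite exprn_ge0 // divr_ge0.
(* Without better entries no round is good, but then the claim is just the bound [alpha], which
   every sweep keeps. *)
have [r0|] := posnP (rank b).
  by have := prob_grover_sweep_le m.+1 c0 IH vb; rewrite r0 !mulr0.
move=> /(exists_success Dm) H.
by rewrite exprS; exact: (prob_grover_sweep_good c0 IH vb).
Qed.

End Bound.
End MaximumFinding.

(** * Longest paths *)

Section Paths.
Variables (R : realType) (n D : nat) (wt : 'I_D.+1 -> R) (G : wdag n D).
Implicit Types (s i j : 'I_n.+1) (p : seq 'I_n.+1).

Lemma path_length_cons s x p :
  path_length wt G s (x :: p) = weight wt G s x + path_length wt G x p.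
Proof. by rewrite /path_length /= big_cons. Qed.

Lemma path_length_nil s : path_length wt G s [::] = 0.
Proof. by rewrite /path_length big_nil. Qed.

Lemma path_length_rcons s p j :
  path_length wt G s (rcons p j) =
  path_length wt G s p + weight wt G (last s p) j.
Proof.
elim: p s => [|x p IH] s /=.
  by rewrite path_length_cons !path_length_nil addrC.
by rewrite !path_length_cons IH addrA.
Qed.

Lemma path_last_ge s p : path (edge G) s p -> (s <= last s p)%N.
Proof.
elim: p s => //= x p IH s /andP[/edge_topo sx /IH]; exact/leq_trans/ltnW.
Qed.

Lemma is_path_self s p : is_path G s s p -> p = [::].
Proof.
case: p => // x p /andP[/= /andP[/edge_topo sx /path_last_ge xl] /eqP lE].
by move: (leq_trans sx xl); rewrite lE ltnn.
Qed.

Lemma is_path_rcons s i j p : is_path G s i p -> edge G i j ->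
  is_path G s j (rcons p j).
Proof.
by move=> /andP[sp /eqP <-] e; rewrite /is_path rcons_path sp e last_rcons /=.
Qed.

Lemma is_path_rconsP s j p : j != s -> is_path G s j p ->
  exists p' i, [/\ p = rcons p' j, is_path G s i p', i = last s p' & edge G i j].
Proof.
move=> js; case/lastP: p => [|p x]; rewrite /is_path.
  by move=> /= /eqP sj; rewrite sj eqxx in js.
rewrite rcons_path last_rcons => /andP[/andP[sp e] /eqP xj].
by rewrite -xj; exists p, (last s p); rewrite sp eqxx.
Qed.

(** By acyclicity only the empty path returns to the source, whatever the weights. *)
Lemma longest_length_source s : is_longest_length wt G s s 0%E.
Proof.
split; first by exists [::]; rewrite ?path_length_nil // /is_path /= eqxx.
by move=> p /is_path_self ->; rewrite path_length_nil.
Qed.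

(** The Bellman equation, split into an upper bound and its attainment. Unreachable in-neighbours
    contribute [-oo], and [b = -oo] forces all of them to be unreachable. *)
Lemma longest_length_step s j (t : 'I_n.+1 -> \bar R) (b : \bar R) : j != s ->
  (forall i, edge G i j -> is_longest_length wt G s i (t i)) ->
  (forall i, edge G i j -> (t i + (weight wt G i j)%:E <= b)%E) ->
  b = -oo%E \/ (exists2 i, edge G i j & b = (t i + (weight wt G i j)%:E)%E) ->
  is_longest_length wt G s j b.
Proof.
move=> js tP ub; case: b ub => [r| |] ub.
- move=> [//|[i e]]; have := tP _ e; case: (t i) => // r' [[p sp pE] pub] [rE].
  split.
    exists (rcons p j); first exact: is_path_rcons sp e.
    by rewrite path_length_rcons pE rE; case/andP: sp => _ /eqP ->.
  move=> _ /(is_path_rconsP js)[p' [i' [-> sp' iE e']]].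
  rewrite path_length_rcons -iE.
  have := ub _ e'; have := tP _ e'; case: (t i') => [r2 [_ H2]|//|H2].
    by rewrite lee_fin => h; apply: le_trans h; rewrite lerD2r; exact: H2.
  by have := H2 p'; rewrite sp'.
- by move=> [//|[i e]]; have := tP _ e; case: (t i).
- move=> _ p; apply/negP => /(is_path_rconsP js)[p' [i' [_ sp' _ e']]].
  have := ub _ e'; have := tP _ e'; case: (t i') => [r2 _|//|/(_ p')].
    by rewrite leeNy_eq.
  by rewrite sp'.
Qed.

End Paths.

(** * The algorithm, its query count and its error *)

Section Algorithm.
Variables (R : realType) (n D : nat) (wt : 'I_D.+1 -> R) (deg : 'I_n.+1 -> nat).
Variable s : 'I_n.+1.

Local Notation table := ('I_n.+1 -> \bar R).
Local Notation prog := (qprog R (dag_query n) (dag_answer n D) bool table).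
Local Notation q0 := ((ord0, ord0) : dag_query n).
Local Notation b0 := ((q0, 0, true) : qbasis (dag_query n) (dag_answer n D) bool).

Definition nbr_queries (j : 'I_n.+1) : {set dag_query n} :=
  [set q : dag_query n | (q.1 == j) && (q.2 < deg j)%N].

Definition candidate (t : table) (a : dag_answer n D) : \bar R :=
  (t a.1 + (wt a.2)%:E)%E.

Definition update (t : table) (j : 'I_n.+1) (x : \bar R) : table :=
  fun i => if i == j then x else t i.

(** Since [(7 / 8) ^+ 6 <= 1 / 2], 18 = 6 * 3 gives a factor [N ^- 3] for [N = n.+1]: one [N] pays
    for the initial rank, one for the union bound over vertices, and one is left. *)
Definition sweeps : nat := (18 * up_log 2 n.+1)%N.

(** The table is classical data of the program tree. Empty lists are treated apart, as the search
    needs a nonempty set; the successor on [up_log 9] provides the rounds [0, ..., up_log 9 d]. *)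
Fixpoint longest_paths (l : seq 'I_n.+1) (t : table) : prog :=
  if l is j :: l' then
    if j == s then longest_paths l' (update t j 0%E)
    else if #|nbr_queries j| == 0%N then longest_paths l' (update t j -oo%E)
    else find_max (candidate t) (nbr_queries j) q0
           sweeps (up_log 9 #|nbr_queries j|).+1
           (fun b => longest_paths l' (update t j b)) -oo%E
  else Return _ _ _ _ t.

Definition longest_paths_alg :
    qalgorithm R (dag_query n) (dag_answer n D) table :=
  QAlgorithm b0 (longest_paths (enum 'I_n.+1) (fun=> -oo%E)).

(** A bound for a single sweep at [j]. *)
Definition vertex_queries (j : 'I_n.+1) : nat :=
  if #|nbr_queries j| == 0%N then 0%N
  else (3 ^ (up_log 9 #|nbr_queries j|).+1)%N.

Lemma query_depth_longest_paths l t :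
  (query_depth (longest_paths l t) <= sweeps * \sum_(j <- l) vertex_queries j)%N.
Proof.
elim: l t => [|j l IH] t; first by rewrite big_nil.
rewrite big_cons mulnDr [longest_paths _ _]/=.
case: ifP => _; first exact: leq_trans (IH _) (leq_addl _ _).
rewrite {1}/vertex_queries; case: ifP => [_|_]; first by rewrite muln0; exact: IH.
by apply: query_depth_find_max => b; exact: IH.
Qed.

Lemma card_nbr_queries_le (j : 'I_n.+1) (X : {set 'I_n.+1}) :
  (forall k : 'I_n.+1, (k < deg j)%N -> k \in X) -> (#|nbr_queries j| <= #|X|)%N.
Proof.
move=> HX; apply: (@leq_trans #|[set (j, k) | k in X]|); last exact: leq_imset_card.
apply/subset_leq_card/fintype.subsetP => -[j' k]; rewrite inE /= => /andP[/eqP -> kd].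
by apply: imset_f; exact: HX.
Qed.

Lemma card_nbr_queries_deg j : (#|nbr_queries j| <= deg j)%N.
Proof.
apply: (@leq_trans #|[set k : 'I_n.+1 | (k < deg j)%N]|).
  by apply: card_nbr_queries_le => k; rewrite inE.
rewrite cardE -(size_map val) -[leqRHS](size_iota 0).
apply: uniq_leq_size; first by rewrite (map_inj_uniq val_inj) enum_uniq.
by move=> _ /mapP[k + ->]; rewrite mem_enum inE mem_iota.
Qed.

Lemma card_nbr_queries_n j : (#|nbr_queries j| <= n.+1)%N.
Proof.
by rewrite -[leqRHS]card_ord -cardsT; apply: card_nbr_queries_le => k; rewrite inE.
Qed.

Lemma vertex_queries_le j :
  (vertex_queries j)%:R <= 9 * Num.sqrt (deg j)%:R :> R.
Proof.
apply: (@le_trans _ _ (9 * Num.sqrt #|nbr_queries j|%:R)); last first.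
  by rewrite ler_pM2l // ler_wsqrtr // ler_nat card_nbr_queries_deg.
rewrite /vertex_queries; case: eqP => [_|/eqP]; first by rewrite mulr_ge0 ?sqrtr_ge0.
move: #|_| => d; rewrite -lt0n => d0.
(* Rounding up to a power of 9 overshoots by at most 9, hence by 3 after the square root; the extra
   round gives another factor 3. *)
have H : (9 ^ up_log 9 d <= 9 * d)%N.
  have [->|d1] := eqVneq d 1%N; first by rewrite up_log1.
  have d1' : (1 < d)%N by rewrite ltn_neqAle eq_sym d1.
  have := @up_log_gtn 9 d isT d1'; have : (0 < up_log 9 d)%N by rewrite up_log_gt0.
  by case: (up_log 9 d) => // k _ /= /ltnW kd; rewrite expnS leq_mul2l.
have -> : 9 * Num.sqrt d%:R = 3 * (3 * Num.sqrt d%:R) :> R by ring.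
rewrite expnS natrM ler_pM2l //.
rewrite -(ler_pXn2r (n := 2)) ?nnegrE ?mulr_ge0 ?sqrtr_ge0 ?ler0n //.
by rewrite exprMn sqr_sqrtr ?ler0n // -!natrX -natrM ler_nat -expnM mulnC expnM.
Qed.

Variable G : wdag n D.
Hypothesis degG : forall j, size (nbrs G j) = deg j.

Lemma edge_query i j : edge G i j ->
  exists2 q, q \in nbr_queries j & dag_oracle G q = (i, wcode G i j).
Proof.
rewrite -mem_nbrs => ij.
have kd : (index i (nbrs G j) < size (nbrs G j))%N by rewrite index_mem.
have kn : (index i (nbrs G j) < n.+1)%N.
  apply: leq_trans kd _; rewrite -(card_uniqP (nbrs_uniq G j)).
  by rewrite -[leqRHS]card_ord max_card.
exists (j, Ordinal kn); first by rewrite inE /= eqxx -degG.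
by rewrite /dag_oracle /= kd nth_index.
Qed.

Lemma query_edge j q : q \in nbr_queries j ->
  exists2 i, edge G i j & dag_oracle G q = (i, wcode G i j).
Proof.
case: q => j' k; rewrite inE /= => /andP[/eqP -> kd].
exists (nth ord0 (nbrs G j) k); last by rewrite /dag_oracle /= degG kd.
by rewrite -mem_nbrs mem_nth // degG.
Qed.

(** Rank 0 gives the upper bound of the Bellman equation, the form of [b] its attainment. *)
Lemma longest_length_best j (t : table) (b : \bar R) : j != s ->
  (forall i, edge G i j -> is_longest_length wt G s i (t i)) ->
  b = -oo%E \/
    (exists2 q, q \in nbr_queries j & b = candidate t (dag_oracle G q)) ->
  rank (candidate t) (nbr_queries j) (dag_oracle G) b = 0%N ->
  is_longest_length wt G s j b.
Proof.
move=> js tP vb r0; apply: longest_length_step js tP _ _.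
  move=> i /edge_query[q qD qE]; rewrite leNgt; apply/negP => bi.
  move/eqP: r0; rewrite cards_eq0 => /eqP/setP/(_ q).
  by move: qD; rewrite !inE qE /candidate /= => ->; rewrite bi.
case: vb => [->|[q /query_edge[i ij qE] ->]]; [by left | right].
by exists i => //; rewrite qE.
Qed.

(** Union bound by induction on the vertices left: each adds one search error, and the entries of
    the vertices already processed are assumed correct. *)
Lemma prob_longest_paths (l : seq 'I_n.+1) (t : table) :
  sorted ltn (map val l) ->
  (forall i, i \notin l -> is_longest_length wt G s i (t i)) ->
  prog_prob (dag_oracle G) [set t | ~ solves_longest_paths wt G s t]%classic
    (longest_paths l t) (ket R b0) <=
  (size l)%:R * ((7 / 8) ^+ sweeps * n.+1%:R).
Proof.
elim: l t => [|j l IH] t srt tP.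
  rewrite /= mul0r; case: asboolP => // -[] i; exact: tP.
have srt' : sorted ltn (map val l) by apply: path_sorted srt.
have ltj (i : 'I_n.+1) : (i < j)%N -> i \notin j :: l.
  move=> ij; rewrite inE negb_or neq_ltn ij /=; apply/negP => il.
  have := order_path_min ltn_trans srt => /allP/(_ (val i)).
  by rewrite map_f // => /(_ isT) /= ji; move: (ltn_trans ij ji); rewrite ltnn.
have upd b : is_longest_length wt G s j b -> forall i, i \notin l ->
    is_longest_length wt G s i (update t j b i).
  move=> bP i il; rewrite /update; case: eqP => [->//|/eqP ij].
  by apply: tP; rewrite inE negb_or ij.
set eps := (7 / 8) ^+ sweeps * _.
have eps0 : 0 <= eps by rewrite mulr_ge0 // exprn_ge0 // divr_ge0.
have leS : (size l)%:R * eps <= (size (j :: l))%:R * eps.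
  by rewrite ler_wpM2r // ler_nat.
rewrite [longest_paths _ _]/=; case: ifPn => [/eqP js|js].
  apply: le_trans leS; apply: IH srt' _; apply: upd.
  by rewrite js; exact: longest_length_source.
have tE i : edge G i j -> is_longest_length wt G s i (t i).
  by move=> /edge_topo/ltj; exact: tP.
case: ifPn => [D0|]; last rewrite -lt0n => D0.
  apply: le_trans leS; apply: IH srt' _; apply: upd.
  apply: longest_length_best js tE (or_introl erefl) _.
  by apply/eqP; rewrite -leqn0 -(eqP D0) subset_leq_card // sub_better.
(* Rank 0 alone does not make [b] correct, since it could exceed every candidate; only values that
   the search can hold are considered. *)
pose valid (b : \bar R) := b = -oo%E \/
    (exists2 q, q \in nbr_queries j & b = candidate t (dag_oracle G q)).
have vq q : q \in nbr_queries j -> valid (candidate t (dag_oracle G q)).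
  by right; exists q.
apply: le_trans (prob_find_max_le (alpha := (size l)%:R * eps) vq D0 _ _ _ _) _.
- exact: up_logP.
- move=> b vb; have [r0|r0] := posnP (rank (candidate t) (nbr_queries j) (dag_oracle G) b).
    by rewrite r0 addr0; apply: IH srt' _; apply: upd; exact: longest_length_best r0.
  (* A value that misses the maximum has rank at least 1, which dominates any failure
     probability. *)
  apply: le_trans (prog_prob_le _ _ _ _) _; rewrite sqnorm_ket.
  by apply: ler_wpDl; [rewrite mulr_ge0 | rewrite ler1n].
- by left.
rewrite /= -[(size l).+1%:R]natr1 [leRHS]mulrDl [1 * eps]mul1r lerD2l.
rewrite /eps ler_wpM2l ?exprn_ge0 ?divr_ge0 //.
rewrite ler_nat; apply: leq_trans (card_nbr_queries_n j).
by rewrite subset_leq_card // sub_better.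
Qed.

Lemma nedgesE : nedges G = (\sum_j deg j)%N.
Proof.
rewrite /nedges -sum1_card (eq_bigl (fun e => edge G e.1 e.2)); last first.
  by move=> e; rewrite inE.
rewrite -(pair_big_dep xpredT (edge G) (fun _ _ => 1%N)) /=.
rewrite (exchange_big_dep xpredT) //=; apply: eq_bigr => j _.
rewrite sum1_card -degG -(card_uniqP (nbrs_uniq G j)).
by apply: eq_card => i; rewrite mem_nbrs.
Qed.

End Algorithm.

(** * Numerical estimates and conclusion *)

Lemma sum_sqrt_le (R : realType) (I : finType) (a : I -> nat) :
  \sum_i Num.sqrt (a i)%:R <= Num.sqrt (#|I| * \sum_i a i)%:R :> R.
Proof.
set x := fun i => Num.sqrt (a i)%:R : R; set S := \sum_i _.
have S0 : 0 <= S by apply: sumr_ge0 => i _; exact: sqrtr_ge0.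
rewrite -(ger0_norm S0) -sqrtr_sqr ler_wsqrtr // natrM natr_sum.
have -> : \sum_i (a i)%:R = \sum_i x i ^+ 2.
  by apply: eq_bigr => i _; rewrite sqr_sqrtr.
set N := \sum_i _.
have -> : S ^+ 2 = \sum_i \sum_j x i * x j.
  by rewrite expr2 mulr_suml; apply: eq_bigr => i _; rewrite mulr_sumr.
(* Cauchy-Schwarz from [x i * x j <= (x i ^+ 2 + x j ^+ 2) / 2]. *)
apply: (@le_trans _ _ (\sum_i \sum_j (x i ^+ 2 / 2 + x j ^+ 2 / 2))).
  apply: ler_sum => i _; apply: ler_sum => j _.
  by have := sqr_ge0 (x i - x j); nra.
rewrite (eq_bigr (fun i => #|I|%:R * (x i ^+ 2 / 2) + N / 2)) => [|i _].
  by rewrite big_split /= sumr_const -mulr_sumr -mulr_suml -/N -[_ *+ #|I|]mulr_natl; lra.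
by rewrite big_split /= sumr_const mulr_natl -mulr_suml.
Qed.

(** The factor 2 absorbs the rounding up, as [ln 2 <= ln n.+1] for [n > 0]; both sides vanish for
    [n = 0]. *)
Lemma up_log2_ln (R : realType) (n : nat) :
  (up_log 2 n.+1)%:R * ln 2 <= 2 * ln n.+1%:R :> R.
Proof.
case: n => [|n]; first by rewrite up_log1 mul0r ln1 mulr0.
have := @up_log_gtn 2 n.+2 isT isT.
have : (0 < up_log 2 n.+2)%N by rewrite up_log_gt0.
case: (up_log 2 n.+2) => // k _ /= /ltnW kn.
have h1 : ln 2 <= ln n.+2%:R :> R by rewrite ler_ln ?posrE // ler_nat.
have h2 : k%:R * ln 2 <= ln n.+2%:R :> R.
  by rewrite mulr_natl -lnXn // ler_ln ?posrE ?exprn_gt0 // -natrX ler_nat.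
by rewrite -natr1; lra.
Qed.

Lemma pow_sweeps_le (R : realType) (n : nat) :
  (7 / 8) ^+ sweeps n <= (n.+1%:R ^+ 3)^-1 :> R.
Proof.
rewrite /sweeps (_ : 18 = 6 * 3)%N // -mulnA exprM mulnC exprM.
rewrite -exprVn; apply: lerXn2r; rewrite ?nnegrE ?invr_ge0 ?exprn_ge0 ?divr_ge0 //.
apply: (@le_trans _ _ (2^-1 ^+ up_log 2 n.+1)).
  by apply: lerXn2r; rewrite ?nnegrE ?invr_ge0 ?exprn_ge0 ?divr_ge0 //; lra.
rewrite exprVn lef_pV2 ?posrE ?exprn_gt0 // -natrX ler_nat.
exact: up_logP.
Qed.

(* The graph has n.+1 vertices; the algorithm knows the number of vertices, the
   table of possible weights, the lengths of the neighbour lists and the source,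
   and has access to the lists and the weights only through queries. *)
Theorem theorem4 (R : realType) :
  exists (alg : forall (n D : nat) (wt : 'I_D.+1 -> R) (deg : 'I_n.+1 -> nat)
                       (s : 'I_n.+1),
            qalgorithm R (dag_query n) (dag_answer n D) ('I_n.+1 -> \bar R))
         (c_time c_err : R),
  forall (n D : nat) (wt : 'I_D.+1 -> R) (deg : 'I_n.+1 -> nat) (s : 'I_n.+1)
         (G : wdag n D),
    (forall j, size (nbrs G j) = deg j) ->
    expected_queries (alg n D wt deg s) (dag_oracle G)
      <= c_time * (Num.sqrt (n.+1 * nedges G)%:R * ln n.+1%:R) /\
    prob_output (alg n D wt deg s) (dag_oracle G)
        [set t | ~ solves_longest_paths wt G s t]%classic
      <= c_err / n.+1%:R.
Proof.
(* 324 = 18 * 9 * 2: the constants of [sweeps], [vertex_queries_le] and [up_log2_ln]. *)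
exists (@longest_paths_alg R), (324 / ln 2), 1 => n D wt deg s G degG; split.
  apply: le_trans (prog_cost_le _ _ _) _; rewrite sqnorm_ket mulr1.
  have ln2 : 0 < ln 2 :> R by rewrite ln_gt0 // ltr1n.
  apply: (@le_trans _ _ ((sweeps n)%:R * (9 * Num.sqrt (n.+1 * nedges G)%:R))).
    apply: le_trans (_ : (sweeps n * \sum_(j <- enum 'I_n.+1) vertex_queries deg j)%:R <= _).
      by rewrite ler_nat; exact: query_depth_longest_paths.
    rewrite natrM ler_wpM2l // natr_sum big_enum /= (nedgesE degG).
    apply: (@le_trans _ _ (\sum_j 9 * Num.sqrt (deg j)%:R)).
      by apply: ler_sum => j _; exact: vertex_queries_le.
    rewrite -mulr_sumr ler_pM2l //.
    by have := sum_sqrt_le R deg; rewrite card_ord.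
  have := up_log2_ln R n; rewrite /sweeps natrM.
  set u := (up_log 2 n.+1)%:R; set w := Num.sqrt _; set v := ln n.+1%:R => h.
  have w0 : 0 <= w by exact: sqrtr_ge0.
  have -> : 324 / ln 2 * (w * v) = (162 * w) * ((2 * v) / ln 2).
    by field; exact: lt0r_neq0.
  have -> : 18 * u * (9 * w) = (162 * w) * u by ring.
  by rewrite ler_wpM2l ?mulr_ge0 // ler_pdivlMr.
apply: le_trans (prob_longest_paths degG _ _) _.
- by rewrite val_enum_ord; exact: iota_ltn_sorted.
- by move=> i; rewrite mem_enum.
rewrite size_enum_ord mulrA mulrAC.
apply: (@le_trans _ _ (n.+1%:R * n.+1%:R * (n.+1%:R ^+ 3)^-1)).
  by apply: ler_wpM2l; [rewrite mulr_ge0 | exact: pow_sweeps_le].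
have : n.+1%:R != 0 :> R by rewrite pnatr_eq0.
by move: n.+1%:R => N N0; rewrite le_eqVlt; apply/orP; left; apply/eqP; field.
Qed.
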